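(* Let $\lambda$ be a nonzero real number. For every integer $n\ge 0$, as polynomials in $x$, $$B_{n,\lambda}^{L}(x)=\sum_{k=0}^{n}(-1)^{n-k}S_{1}(n,k)B_{k,\lambda}(x).$$
   Context: For $0\ne\lambda\in\mathbb{R}$, put $(x)_{0,\lambda}=1$ and $(x)_{n,\lambda}=x(x-\lambda)\cdots(x-(n-1)\lambda)$ for $n\ge 1$; the degenerate exponential function is $e_\lambda^x(t)=(1+\lambda t)^{x/\lambda}=\sum_{n=0}^\infty (x)_{n,\lambda}\frac{t^n}{n!}$. The degenerate Lah-Bell polynomials $B_{n,\lambda}^L(x)$ are defined by $e_\lambda^x\left(\frac{1}{1-t}-1\right)=\sum_{n=0}^\infty B_{n,\lambda}^L(x)\frac{t^n}{n!}$, and the degenerate Bell polynomials $B_{n,\lambda}(x)$ by $e_\lambda^x(e^t-1)=\sum_{n=0}^\infty B_{n,\lambda}(x)\frac{t^n}{n!}$ (formal power series in $t$). The Stirling numbers of the first kind $S_1(n,k)$ (signed) are defined by $(x)_n=\sum_{k=0}^n S_1(n,k)x^k$, where $(x)_0=1$ and $(x)_n=x(x-1)\cdots(x-n+1)$ for $n\ge 1$. *)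

(* Defs.v *)
From HB Require Import structures.
From mathcomp Require Import all_boot all_order all_algebra.
From mathcomp Require Import reals.

Set Implicit Arguments.
Unset Strict Implicit.
Unset Printing Implicit Defensive.

Import Order.TTheory GRing.Theory Num.Theory.

Local Open Scope ring_scope.

(** Formal power series in t, given by their sequences of coefficients. *)
Definition fps (A : Type) := nat -> A.

Section FormalPowerSeries.
Variable A : nzRingType.
Implicit Types f g : fps A.

Definition fps_one : fps A := fun n => (n == 0%N)%:R.

Definition fps_X : fps A := fun n => (n == 1%N)%:R.

Definition fps_sub f g : fps A := fun n => f n - g n.

Definition fps_mul f g : fps A := fun n => \sum_(i < n.+1) f i * g (n - i)%N.

Definition fps_pow f k : fps A := iter k (fps_mul f) fps_one.

(** The inverse of 1 - t, see [fps_geomP]. *)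
Definition fps_geom : fps A := fun _ => 1.

Lemma fps_geomP : fps_mul (fps_sub fps_one fps_X) fps_geom =1 fps_one.
Proof.
move=> n; rewrite /fps_mul /fps_sub /fps_one /fps_X /fps_geom.
rewrite big_ord_recl /= subr0 mulr1; case: n => [|n]; first by rewrite big_ord0 addr0.
rewrite big_ord_recl big1 => [|i _] /=; first by rewrite mulr1 sub0r addr0 subrr.
by rewrite subrr mul0r.
Qed.

End FormalPowerSeries.

Arguments fps_one {A}.
Arguments fps_X {A}.
Arguments fps_geom {A}.

(** The composite F(g(t)), for a series F with coefficients in an R-module V
    and a scalar series g without constant term: the n-th coefficient of g^k
    then vanishes for k > n, so that the infinite sum over k stops at n. *)
Definition fps_comp (R : nzRingType) (V : lmodType R) (F : fps V) (g : fps R) :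
  fps V := fun n => \sum_(k < n.+1) fps_pow g k n *: F k.

Section DegeneratePolynomials.
Variable R : realType.
Implicit Type lambda : R.

(** e^t *)
Definition fps_expt : fps R := fun n => n`!%:R^-1.

(** (x)_{n,lambda} = x (x - lambda) ... (x - (n - 1) lambda) *)
Definition deg_ffact lambda n : {poly R} :=
  \prod_(i < n) ('X - (i%:R * lambda)%:P).

(** e_lambda^x(t), as a power series whose coefficients are polynomials in x *)
Definition deg_exp lambda : fps {poly R} :=
  fun n => n`!%:R^-1 *: deg_ffact lambda n.

(** The factor n! extracts the coefficient of t^n / n!. *)
Definition deg_Lah_Bell lambda n : {poly R} :=
  n`!%:R *: fps_comp (deg_exp lambda) (fps_sub fps_geom fps_one) n.

Definition deg_Bell lambda n : {poly R} :=
  n`!%:R *: fps_comp (deg_exp lambda) (fps_sub fps_expt fps_one) n.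

End DegeneratePolynomials.

(** (x)_n = x (x - 1) ... (x - n + 1), in the variable x *)
Definition ffact_poly (A : nzRingType) n : {poly A} :=
  \prod_(i < n) ('X - i%:R%:P).

(** Signed Stirling numbers of the first kind, see [ffact_polyE]. *)
Definition stirling1 n k : int := (ffact_poly int n)`_k.

Lemma ffact_polyE (A : comNzRingType) n :
  ffact_poly A n = \sum_(k < n.+1) (stirling1 n k)%:~R *: 'X^k.
Proof.
have -> : ffact_poly A n = map_poly intr (ffact_poly int n).
  rewrite /ffact_poly rmorph_prod; apply: eq_bigr => i _ /=.
  by rewrite rmorphB /= map_polyX map_polyC /= mulrz_nat.
have szE : size (ffact_poly int n) = n.+1.
  by rewrite size_prod_XsubC /index_enum -enumT size_enum_ord.
rewrite /map_poly szE poly_def.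
by [].
Qed.

(* Main.v *)
Require Import Defs.
From HB Require Import structures.
From mathcomp Require Import all_boot all_order all_algebra.
From mathcomp Require Import reals ring.

Set Implicit Arguments.
Unset Strict Implicit.
Unset Printing Implicit Defensive.

Import Order.TTheory GRing.Theory Num.Theory.

Local Open Scope ring_scope.

(** Both families are composites of the same series e_lambda^x, and the identity
    is linear in the coefficients of that series; so it suffices to relate, for
    each m, the coefficients of (1/(1-t) - 1)^m to those of (e^t - 1)^m
    ([stirling1_fps_pow_sub1]).  Such a relation exists because 1/(1-t) - 1 is
    e^u - 1 at u = - log(1-t), and the Stirling numbers of the first kind are,
    up to sign and factorials, the coefficients of the powers of the logarithm.

    The logarithm is avoided as follows.  By the binomial theorem
    ([fps_pow_sub1]), (f - 1)^m is the same linear combination of the powers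
    f^j for f = 1/(1-t) as for f = e^t, so that only the powers of these two
    series need to be compared ([stirling1_fps_pow]).  These are explicit: n!
    times the n-th coefficient of (1-t)^(-j) is j (j + 1) ... (j + n - 1)
    ([fps_pow_geom]), k! times the k-th coefficient of e^(jt) is j^k
    ([fps_pow_expt]), and the expansion of the rising factorial in powers of j
    is the definition of the Stirling numbers evaluated at - j
    ([stirling1_rising]). *)

Section Powers.
Variable A : nzRingType.
Implicit Types f g : fps A.

(** Truncation turns the powers of a series into powers in the ring of
    polynomials, where the binomial theorem is available. *)
Lemma coef_trunc_pow f N k n : (n < N)%N ->
  ((\poly_(i < N) f i) ^+ k)`_n = fps_pow f k n.
Proof.
elim: k n => [|k IHk] n ltnN; first by rewrite expr0 coef1.
rewrite exprS coefM; apply: eq_bigr => i _.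
have leiN : (i < N)%N by apply: leq_ltn_trans ltnN; rewrite -ltnS.
by rewrite coef_poly leiN IHk // (leq_ltn_trans (leq_subr _ _)).
Qed.

Lemma fps_pow_sub1 f m n :
  fps_pow (fps_sub f fps_one) m n =
  \sum_(i < m.+1) ((-1) ^+ i * fps_pow f (m - i) n) *+ 'C(m, i).
Proof.
rewrite -(@coef_trunc_pow _ n.+1) //.
have -> : \poly_(i < n.+1) fps_sub f fps_one i = \poly_(i < n.+1) f i - 1.
  apply/polyP => i; rewrite coefB !coef_poly coef1 /fps_sub /fps_one.
  by case: ltnP => //; case: i => // i _; rewrite subr0.
rewrite exprBn_comm; last exact: commr1.
rewrite coef_sum; apply: eq_bigr => i _; rewrite expr1n mulr1 coefMn.
rewrite -(@coef_trunc_pow _ n.+1) // -signr_odd -[in RHS]signr_odd.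
by case: odd; rewrite ?mul1r ?mulN1r ?coefN.
Qed.

Lemma fps_pow_eq0 g m n : g 0%N = 0 -> (n < m)%N -> fps_pow g m n = 0.
Proof.
move=> g0; elim: m n => // m IHm n ltnm /=.
rewrite /fps_mul big_ord_recl g0 mul0r add0r big1 // => i _.
by rewrite IHm ?mulr0 // (leq_trans _ (ltnm : (n <= m)%N)) // ltn_subrL /=
  (leq_ltn_trans _ (ltn_ord i)).
Qed.

(** Pascal's rule: multiplying by 1/(1-t) forms partial sums of coefficients. At
    j = 0 the truncated predecessor still gives the coefficients of the series
    1. *)
Lemma fps_pow_geom j n : fps_pow (@fps_geom A) j n = 'C((j + n).-1, n)%:R.
Proof.
elim: j n => [|j IHj] n.
  by case: n => //= n; rewrite bin_small.
elim: n => [|n IHn].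
  by rewrite /= /fps_mul big_ord_recl big_ord0 IHj !bin0 mul1r addr0.
rewrite [LHS]/= /fps_mul big_ord_recl /= mul1r -/(fps_pow _ _).
rewrite subn0 IHj [X in _ + X](_ : _ = fps_pow fps_geom j.+1 n) //.
by rewrite IHn addSn addnS /= binS natrD.
Qed.

End Powers.

Lemma fps_comp_widen (R : nzRingType) (V : lmodType R) (F : fps V) (g : fps R)
    N n : g 0%N = 0 -> (n <= N)%N ->
  fps_comp F g n = \sum_(k < N.+1) fps_pow g k n *: F k.
Proof.
move=> g0 leqnN; rewrite /fps_comp.
rewrite (big_ord_widen _ (fun k => fps_pow g k n *: F k) (leqnN : n < N.+1)%N).
rewrite big_mkcond; apply: eq_bigr => k _; case: ltnP => // ltnk.
by rewrite fps_pow_eq0 ?scale0r.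
Qed.

(** The binomial theorem for (j + 1)^n is the product rule e^(jt) e^t. *)
Lemma fps_pow_expt (R : realType) j n :
  fps_pow (@fps_expt R) j n = j%:R ^+ n / n`!%:R.
Proof.
have factU m : (m`!%:R : R) != 0 by rewrite pnatr_eq0 -lt0n fact_gt0.
elim: j n => [|j IHj] n /=.
  by rewrite expr0n /fps_one; case: n => [|n]; rewrite ?mul0r ?divr1.
rewrite -addn1 natrD exprDn mulr_suml; apply: eq_bigr => i _.
have leqin : (i <= n)%N by rewrite -ltnS.
rewrite IHj /fps_expt expr1n mulr1 -[_ *+ 'C(n, i)]mulr_natr.
rewrite -(bin_fact leqin) !natrM.
have binU : ('C(n, i)%:R : R) != 0 by rewrite pnatr_eq0 -lt0n bin_gt0.
by field; rewrite !factU binU.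
Qed.

Section Stirling.
Variable A : comNzRingType.

(** The substitution x = - j in the definition of the Stirling numbers turns
    the falling factorial into (-1)^n j (j + 1) ... (j + n - 1). *)
Lemma stirling1_rising n j :
  \sum_(k < n.+1) (-1) ^+ (n - k) * (stirling1 n k)%:~R * j%:R ^+ k =
  ((j + n).-1 ^_ n)%:R :> A.
Proof.
transitivity ((-1) ^+ n * (ffact_poly A n).[- j%:R]).
  rewrite ffact_polyE horner_sum mulr_sumr; apply: eq_bigr => k _.
  have leqkn : (k <= n)%N by rewrite -ltnS.
  have -> : (-1) ^+ n = (-1) ^+ (n - k) * (-1) ^+ k :> A.
    by rewrite -exprD subnK.
  rewrite hornerZ hornerXn (exprNn j%:R) -!mulrA.
  by rewrite [in RHS](mulrCA (stirling1 n k)%:~R) signrMK.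
elim: n => [|n IHn].
  by rewrite /ffact_poly big_ord0 hornerC mulr1 ffactn0.
rewrite /ffact_poly big_ord_recr -/(ffact_poly A n) hornerM exprSr.
rewrite hornerXsubC addnS /= ffactnS natrM -IHn natrD.
by ring.
Qed.

End Stirling.

(** Coefficientwise form of the substitution u = - log(1-t), which sends e^(ju)
    to (1-t)^(-j). *)
Lemma stirling1_fps_pow (R : realType) n j :
  \sum_(k < n.+1) (-1) ^+ (n - k) * (stirling1 n k)%:~R *
     (k`!%:R * fps_pow (@fps_expt R) j k) =
  n`!%:R * fps_pow (@fps_geom R) j n.
Proof.
rewrite fps_pow_geom -natrM mulnC bin_ffact -stirling1_rising.
apply: eq_bigr => k _; rewrite fps_pow_expt [k`!%:R * _]mulrCA divff ?mulr1 //.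
by rewrite pnatr_eq0 -lt0n fact_gt0.
Qed.

(** The coefficients 'C(m, i) (-1)^i of the binomial expansion are the same on
    both sides, and the sums over i and k commute. *)
Lemma stirling1_fps_pow_sub1 (R : realType) n m :
  \sum_(k < n.+1) (-1) ^+ (n - k) * (stirling1 n k)%:~R *
     (k`!%:R * fps_pow (fps_sub (@fps_expt R) fps_one) m k) =
  n`!%:R * fps_pow (fps_sub (@fps_geom R) fps_one) m n.
Proof.
rewrite fps_pow_sub1 mulr_sumr.
under eq_bigr do rewrite fps_pow_sub1 !mulr_sumr.
rewrite exchange_big; apply: eq_bigr => i _ /=.
rewrite -mulrnAl mulrCA -stirling1_fps_pow mulr_sumr; apply: eq_bigr => k _.
by rewrite -mulrnAl [in RHS]mulrCA; congr (_ * _); rewrite mulrCA.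
Qed.

Theorem mainTheorem15 (R : realType) (lambda : R) (hlambda : lambda != 0)
    (n : nat) :
  deg_Lah_Bell lambda n =
  \sum_(k < n.+1)
     ((-1) ^+ (n - k)%N * (stirling1 n k)%:~R) *: deg_Bell lambda k.
Proof.
have geom0 : fps_sub fps_geom fps_one 0 = 0 :> R by rewrite /fps_sub subrr.
have expt0 : fps_sub (@fps_expt R) fps_one 0 = 0.
  by rewrite /fps_sub /fps_expt fact0 invr1 subrr.
rewrite /deg_Lah_Bell (fps_comp_widen _ geom0 (leqnn n)) scaler_sumr.
(* The inner sums are extended to a common range, so that they can be
   exchanged with the sum over k. *)
have BellE (k : 'I_n.+1) : deg_Bell lambda k = \sum_(m < n.+1)
    (k`!%:R * fps_pow (fps_sub (@fps_expt R) fps_one) m k) *: deg_exp lambda m.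
  rewrite /deg_Bell (@fps_comp_widen _ _ _ _ n) // -1?ltnS // scaler_sumr.
  by apply: eq_bigr => m _; rewrite scalerA.
under [RHS]eq_bigr do rewrite BellE scaler_sumr.
rewrite exchange_big; apply: eq_bigr => m _ /=.
rewrite scalerA -stirling1_fps_pow_sub1 scaler_suml.
by apply: eq_bigr => k _; rewrite [RHS]scalerA.
Qed.
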